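(* A mapping $f\in C^1(\mathbb{R}^n;\mathbb{R}^n)$ is a (global) diffeomorphism onto $\mathbb{R}^n$ if and only if (i) $\det f'(x)\neq0$ for every $x\in\mathbb{R}^n$, and (ii) there exists a coercive function $k\in C^1(\mathbb{R}^n;\mathbb{R}_+)$ such that $$\sup\{\|k'(x)\circ f'(x)^{-1}\|: x\in\mathbb{R}^n\}<+\infty,$$ equivalently $\sup\{|\nabla k(x)\cdot f'(x)^{-1}u|: x\in\mathbb{R}^n,\ u\in\mathbb{R}^n,\ |u|=1\}<+\infty$.
   Context: $\mathbb{R}_+=[0,+\infty)$. A function $k:\mathbb{R}^n\to\mathbb{R}_+$ is coercive if it is continuous and $k(x)\to+\infty$ as $|x|\to+\infty$. $\|\cdot\|$ denotes the operator norm of a linear functional. *)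

(* Defs.v *)
From HB Require Import structures.
From mathcomp Require Import all_boot all_order all_algebra.
From mathcomp Require Import all_classical all_reals all_analysis.
Set Implicit Arguments. Unset Strict Implicit. Unset Printing Implicit Defensive.
Import Order.TTheory GRing.Theory Num.Theory.
Import numFieldNormedType.Exports.
Local Open Scope ring_scope.

Definition enorm (R : realType) (n : nat) (u : 'rV[R]_n) : R :=
  Num.sqrt (\sum_(i < n) u ord0 i ^+ 2).

(* C^1 : differentiable everywhere with continuous derivative.  In finite
   dimension, continuity of x |-> f'(x) is equivalent to continuity of each
   x |-> f'(x) v. *)
Definition C1 (R : realType) (V W : normedModType R) (f : V -> W) : Prop :=
  (forall x : V, differentiable f x) /\
  (forall v : V, continuous (fun x : V => 'd f x v)).

(* Jacobian matrix (row-vector convention: u *m jac f x = 'd f x u). *)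
Definition jac (R : realType) (n : nat) (f : 'rV[R]_n -> 'rV[R]_n)
  (x : 'rV[R]_n) : 'M[R]_n := lin1_mx ('d f x).

Definition diffeo (R : realType) (n : nat) (f : 'rV[R]_n -> 'rV[R]_n) : Prop :=
  exists g : 'rV[R]_n -> 'rV[R]_n,
    [/\ cancel f g, cancel g f, C1 f & C1 g].

Definition coercive (R : realType) (n : nat) (k : 'rV[R]_n -> R) : Prop :=
  continuous k /\
  forall M : R, exists r : R, forall x, r < enorm x -> M <= k x.

(* Main.v *)
(** The Newton field v(x) = f'(x)^-1 (y - f x) points f x towards y.  On a
    compact set, a single small step eta(x) = x + t v(x) contracts |y - f x| by
    a factor q < 1 and raises k by at most t (M + 1) |y - f x|, because
    k' o f'^-1 is bounded by M.  Hence eta preserves every sublevel set K of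
    k + 2 (M + 1) |y - f|, which is compact by coercivity.
    - Surjectivity: a minimiser of |y - f| on K must be a preimage of y.
    - Injectivity: let x1, x2 be two preimages of y.  Both are fixed by eta, so
      the image of the segment [x1, x2] under eta^N is a path in K joining them,
      along which |y - f| is as small as we like.  Such a path crosses a small
      sphere around x1, where |y - f| is bounded below since x1 is an isolated
      preimage.
    - The preimage g y found in K has k (g y) <= k x + 2 (M + 1) |y - f x|, so
      g is locally bounded, hence continuous, hence C^1.
    Conversely, k = sum_i sqrt (1 + f_i^2) works when f is a diffeomorphism. *)
Require Import Defs.
From HB Require Import structures.
From mathcomp Require Import all_boot all_order all_algebra.
From mathcomp Require Import all_classical all_reals all_analysis.
From mathcomp Require Import perm ring lra.
Set Implicit Arguments.
Unset Strict Implicit.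
Unset Printing Implicit Defensive.
Import Order.TTheory GRing.Theory Num.Theory.
Import numFieldNormedType.Exports.
Local Open Scope ring_scope.
Local Open Scope classical_set_scope.

(** * Sup norm, coordinates and the Euclidean norm *)

Lemma coord_le_norm (R : realType) (m n : nat) (A : 'M[R]_(m, n)) i j :
  `|A i j| <= `|A|.
Proof.
rewrite [leRHS]/Num.norm /= mx_normrE; apply/bigmax_geP; right => /=.
by exists (i, j).
Qed.

Lemma norm_le_coord (R : realType) (m n : nat) (A : 'M[R]_(m, n)) (c : R) :
  0 <= c -> (forall i j, `|A i j| <= c) -> `|A| <= c.
Proof.
move=> c0 Ac; rewrite [leLHS]/Num.norm /= mx_normrE; apply/bigmax_leP; split=> //.
Qed.

Lemma norm_le_enorm (R : realType) (n : nat) (u : 'rV[R]_n) : `|u| <= enorm u.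
Proof.
apply: norm_le_coord => [|i j]; first exact: sqrtr_ge0.
rewrite (ord1 i) -sqrtr_sqr ler_wsqrtr// (bigD1 j)//= lerDl.
by apply: sumr_ge0 => k _; exact: sqr_ge0.
Qed.

(** The norm [|u|] of a row vector is the sup norm of its entries. Since n <= n^2, the crude
    constant n can stand in for its square root. *)
Lemma enorm_le_norm (R : realType) (n : nat) (u : 'rV[R]_n) :
  enorm u <= n%:R * `|u|.
Proof.
have n0 : 0 <= n%:R * `|u| by rewrite mulr_ge0.
rewrite -(ger0_norm n0) -sqrtr_sqr ler_wsqrtr//.
apply: (@le_trans _ _ (\sum_(i < n) `|u| ^+ 2)).
  apply: ler_sum => i _; rewrite -real_normK ?num_real//.
  by rewrite lerXn2r ?nnegrE// coord_le_norm.
rewrite sumr_const card_ord exprMn -[leLHS]mulr_natl ler_wpM2r ?sqr_ge0//.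
by rewrite -natrX ler_nat; case: (n) => // k; rewrite leq_pmulr.
Qed.

(** * Continuity of matrix-valued maps, determinants and inverses *)

Lemma cvg_mx_coord (R : realType) (T : Type) (F : set_system T) (m n : nat)
    (A : T -> 'M[R]_(m, n)) (B : 'M[R]_(m, n)) : Filter F ->
  (forall i j, (fun x => A x i j) @ F --> B i j) -> A @ F --> B.
Proof.
move=> FF AB; apply/cvg_mx_entourageP => E entE.
have AB' (ij : 'I_m * 'I_n) :
    \forall x \near F, (B ij.1 ij.2, A x ij.1 ij.2) \in E.
  near=> x; rewrite inE; near: x.
  by have /cvg_app_entourageP /(_ _ entE) := AB ij.1 ij.2.
have := filter_forall FF AB'.
by apply: filterS => x ABx i j; exact: (ABx (i, j)).
Unshelve. all: by end_near. Qed.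

Lemma continuous_mx_coord (R : realType) (T : topologicalType) (m n : nat)
    (A : T -> 'M[R]_(m, n)) :
  (forall i j, continuous (fun x => A x i j)) -> continuous A.
Proof. by move=> cA x; apply: cvg_mx_coord => i j; exact: cA. Qed.

Lemma continuous_coord_mx (R : realType) (T : topologicalType) (m n : nat)
    (A : T -> 'M[R]_(m, n)) i j :
  continuous A -> continuous (fun x => A x i j).
Proof. move=> cA x.
exact: (@continuous_comp _ _ _ A (fun M : 'M[R]_(m, n) => M i j) x (cA x)
  (@coord_continuous R m n i j (A x))).
Qed.

Lemma continuous_sumr (R : realType) (T : topologicalType) (I : finType)
    (P : pred I) (F : I -> T -> R) :
  (forall i, P i -> continuous (F i)) ->
  continuous (fun x => \sum_(i | P i) F i x).
Proof.
exact: (@continuous_big R I +%R 0 P (@add_continuous R) T _ F).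
Qed.

Lemma continuous_prodr (R : realType) (T : topologicalType) (I : finType)
    (P : pred I) (F : I -> T -> R) :
  (forall i, P i -> continuous (F i)) ->
  continuous (fun x => \prod_(i | P i) F i x).
Proof.
exact: (@continuous_big R I *%R 1 P (@mul_continuous R) T _ F).
Qed.

Lemma continuous_mulmx (R : realType) (T : topologicalType) (m n p : nat)
    (A : T -> 'M[R]_(m, n)) (B : T -> 'M[R]_(n, p)) :
  continuous A -> continuous B -> continuous (fun x => A x *m B x).
Proof.
move=> cA cB; apply: continuous_mx_coord => i j.
rewrite (_ : (fun x => _) = fun x => \sum_k A x i k * B x k j); last first.
  by apply/funext => x; rewrite mxE.
apply: continuous_sumr => k _ x.
by apply: continuousM; exact: continuous_coord_mx.
Qed.

Lemma continuous_det (R : realType) (T : topologicalType) (n : nat)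
    (A : T -> 'M[R]_n) : continuous A -> continuous (fun x => \det (A x)).
Proof.
move=> cA.
apply: (@continuous_sumr R T {perm 'I_n} predT
  (fun s x => (-1) ^+ s * \prod_i A x i (s i))) => s _ x.
apply: (@continuousM R T (fun=> (-1) ^+ s) (fun x => \prod_i A x i (s i))).
  exact: cst_continuous.
by apply: continuous_prodr => i _; exact: continuous_coord_mx.
Qed.

(** By Cramer's rule each entry of the inverse is a cofactor divided by the determinant. *)
Lemma continuous_invmx (R : realType) (T : topologicalType) (n : nat)
    (A : T -> 'M[R]_n) : (forall x, A x \in unitmx) ->
  continuous A -> continuous (fun x => invmx (A x)).
Proof.
move=> uA cA; apply: continuous_mx_coord => i j.
rewrite (_ : (fun x => _) = fun x => (\det (A x))^-1 *
    ((-1) ^+ (j + i) * \det (row' j (col' i (A x))))); last first.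
  by apply/funext => x; rewrite /invmx uA !mxE.
have cC : continuous (fun x => \det (row' j (col' i (A x)))).
  apply: continuous_det; apply: continuous_mx_coord => k l.
  rewrite (_ : (fun x => _) = fun x => A x (lift j k) (lift i l)).
    exact: continuous_coord_mx.
  by apply/funext => y; rewrite !mxE.
move=> x; apply: (@continuousM R T (fun x => (\det (A x))^-1)).
  apply: (@continuousV R T (fun x => \det (A x))); last exact: continuous_det.
  by have := uA x; rewrite unitmxE unitfE.
by apply: (@continuousM R T (fun=> _)); [exact: cst_continuous|exact: cC].
Qed.

Lemma continuous_near_lt (R : realType) (T : topologicalType) (s : T -> R)
    (x0 : T) (c : R) : continuous s -> s x0 < c -> \forall x \near x0, s x < c.
Proof. by move=> cs sc; apply: (cvgr_lt (s x0)) => //; exact: cs. Qed.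

Lemma continuous_dist (R : realType) (T : topologicalType)
    (W : normedModType R) (F : T -> W) (w : W) :
  continuous F -> continuous (fun x => `|F x - w|).
Proof.
by move=> cF x; apply: cvg_norm; apply: cvgB; [exact: cF|exact: cvg_cst].
Qed.

(** * Linear maps and strict differentiability of C^1 maps *)

Lemma linear_row_delta (R : realType) (n : nat) (W : normedModType R)
    (D : {linear 'rV[R]_n -> W}) (h : 'rV[R]_n) :
  D h = \sum_j h 0 j *: D (delta_mx 0 j).
Proof.
rewrite {1}(row_sum_delta h) linear_sum.
by apply: eq_bigr => j _; rewrite linearZ.
Qed.

(** The sum over the canonical basis replaces the operator norm: it dominates it, and its continuity
    in the map is immediate. *)
Lemma norm_linear_le (R : realType) (n : nat) (W : normedModType R)
    (D : {linear 'rV[R]_n -> W}) (h : 'rV[R]_n) :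
  `|D h| <= (\sum_j `|D (delta_mx 0 j)|) * `|h|.
Proof.
rewrite linear_row_delta mulr_suml.
apply: le_trans (ler_norm_sum _ _ _) _; apply: ler_sum => j _.
by rewrite normrZ mulrC ler_wpM2l// coord_le_norm.
Qed.

Lemma norm_linear_sub_le (R : realType) (n : nat) (W : normedModType R)
    (D E : {linear 'rV[R]_n -> W}) (h : 'rV[R]_n) :
  `|D h - E h| <= (\sum_j `|D (delta_mx 0 j) - E (delta_mx 0 j)|) * `|h|.
Proof.
rewrite (linear_row_delta D) (linear_row_delta E) -sumrB mulr_suml.
apply: le_trans (ler_norm_sum _ _ _) _; apply: ler_sum => j _.
by rewrite -scalerBr normrZ mulrC ler_wpM2l// coord_le_norm.
Qed.

(** Continuity of the derivative in each direction becomes continuity in operator norm, because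
    finitely many basis vectors control all h. *)
Lemma C1_near_diff (R : realType) (n : nat) (W : normedModType R)
    (f : 'rV[R]_n -> W) (x0 : 'rV[R]_n) (e : R) :
  C1 f -> 0 < e ->
  \forall x \near x0, forall h, `|'d f x h - 'd f x0 h| <= e * `|h|.
Proof.
move=> [_ cdf] e0.
pose s x := \sum_j `|'d f x (delta_mx 0 j) - 'd f x0 (delta_mx 0 j)|.
have cs : continuous s.
  apply: continuous_sumr => j _.
  exact: (@continuous_dist _ _ _ _ _ (cdf _)).
have s0 : s x0 = 0 by rewrite /s big1// => j _; rewrite subrr normr0.
have sx0 : \forall x \near x0, s x < e by apply: continuous_near_lt; rewrite ?s0.
near=> x => h.
apply: le_trans (norm_linear_sub_le ('d f x) ('d f x0) h) _.
by rewrite ler_wpM2r// ltW//; near: x.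
Unshelve. all: by end_near. Qed.

Lemma is_diff_line (R : realType) (V : normedModType R) (x h : V) (t : R) :
  is_diff t (fun s : R => x + s *: h) ( *:%R ^~ h).
Proof.
have H : is_diff t (cst x + ( *:%R ^~ h)) (0 + ( *:%R ^~ h)) by exact: is_diffD.
by rewrite add0r in H.
Qed.

Lemma is_derive_line (R : realType) (V : normedModType R) (g : V -> R)
    (x h : V) (t : R) : differentiable g (x + t *: h) ->
  is_derive t 1 (fun s : R => g (x + s *: h)) ('d g (x + t *: h) h).
Proof.
move=> dg; have dl := is_diff_line x h t.
have dgl : differentiable (g \o (fun s : R => x + s *: h)) t.
  exact: differentiable_comp.
apply: DeriveDef; first exact: diff_derivable.
rewrite deriveE// diff_comp//=.
by rewrite (@diff_val _ _ _ _ _ _ _ dl) scale1r.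
Qed.

Lemma mean_value_line (R : realType) (V : normedModType R) (g : V -> R)
    (x h : V) : (forall y, differentiable g y) ->
  exists2 c : R, 0 <= c <= 1 & g (x + h) - g x = 'd g (x + c *: h) h.
Proof.
move=> dg; have dgl t := is_derive_line (dg (x + t *: h)).
have [|c c01] := @MVT_segment R (fun s => g (x + s *: h))
  (fun t => 'd g (x + t *: h) h) 0 1 ler01 (fun t _ => dgl t).
  apply: continuous_subspaceT => t.
  apply: differentiable_continuous; apply/derivable1_diffP; by case: (dgl t).
rewrite scale1r scale0r addr0 subr0 mulr1 => gE.
by exists c => //; move: c01; rewrite in_itv.
Qed.

(** Balls are convex: x + c h is a convex combination of x and x + h. *)
Lemma norm_segment_lt (R : realType) (V : normedModType R) (x0 x h : V)
    (c d : R) : 0 <= c <= 1 -> `|x - x0| < d -> `|x + h - x0| < d ->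
  `|x + c *: h - x0| < d.
Proof.
move=> /andP[c0 c1]; rewrite (addrAC x (c *: h)) (addrAC x h).
move: (x - x0) => w wd whd.
have -> : w + c *: h = (1 - c) *: w + c *: (w + h).
  by rewrite scalerBl scale1r scalerDr addrA subrK.
apply: (@le_lt_trans _ _ (Num.max `|w| `|w + h|)); last by rewrite gt_max wd whd.
apply: le_trans (ler_normD _ _) _.
rewrite !normrZ (ger0_norm c0) (ger0_norm (_ : 0 <= 1 - c)) ?subr_ge0//.
have [Am Bm] : `|w| <= Num.max `|w| `|w + h| /\ `|w + h| <= Num.max `|w| `|w + h|.
  by rewrite !le_max !lexx orbT.
by move: (Num.max _ _) Am Bm => m; nra.
Qed.

Lemma dist_le_split (R : realType) (W : normedModType R) (p q r : W) (e a : R) :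
  `|p - r| <= e / 2 * a -> `|q - r| <= e / 2 * a -> `|p - q| <= e * a.
Proof.
move=> pr qr; rewrite (splitr e) mulrDl -(subrKA r).
by apply: le_trans (ler_normD _ _) (lerD pr _); rewrite distrC.
Qed.

(** The base point x varies, and d does not depend on it. By the mean value theorem the increment is
    the derivative at an intermediate point; that derivative and the one at x are both within e / 2
    of the one at x0. *)
Lemma strict_diff_scalar (R : realType) (n : nat) (g : 'rV[R]_n -> R)
    (x0 : 'rV[R]_n) (e : R) : C1 g -> 0 < e ->
  exists2 d : R, 0 < d & forall x h, `|x - x0| < d -> `|x + h - x0| < d ->
    `|g (x + h) - g x - 'd g x h| <= e * `|h|.
Proof.
move=> C1g e0; have e20 : 0 < e / 2 by rewrite divr_gt0.
have /nbhs_ballP[d /= d0 dP] := C1_near_diff x0 C1g e20.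
exists d => // x h xd zd.
have dx0 y : `|y - x0| < d -> `|'d g y h - 'd g x0 h| <= e / 2 * `|h|.
  move=> yd; apply: dP.
  by rewrite -ball_normE /ball_ /= distrC.
have [c c01 ->] := mean_value_line x h C1g.1.
exact: (dist_le_split (dx0 _ (norm_segment_lt c01 xd zd)) (dx0 _ xd)).
Qed.

Lemma is_diff_coord (R : realType) (m n : nat) (A : 'M[R]_(m, n)) i j :
  is_diff A (fun B : 'M[R]_(m, n) => B i j) (fun B => B i j).
Proof.
have lc : linear (fun B : 'M[R]_(m, n) => B i j) by move=> a u v; rewrite !mxE.
pose cM := GRing.isLinear.Build _ _ _ _ _ lc.
pose cL : {linear 'M[R]_(m, n) -> R} := HB.pack (fun B : 'M[R]_(m, n) => B i j) cM.
have cc : continuous cL by exact: coord_continuous.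
apply: DiffDef; first exact: differentiable_coord.
exact: (@diff_lin _ _ _ cL A cc).
Qed.

Lemma is_diff_comp_coord (R : realType) (V : normedModType R) (m n : nat)
    (f : V -> 'M[R]_(m, n)) (x : V) i j : differentiable f x ->
  is_diff x (fun y => f y i j) (fun h => 'd f x h i j).
Proof.
move=> df; have dc := is_diff_coord (f x) i j.
exact: (is_diff_comp (differentiableP df) dc).
Qed.

Lemma diff_comp_coord (R : realType) (V : normedModType R) (m n : nat)
    (f : V -> 'M[R]_(m, n)) (x h : V) i j : differentiable f x ->
  'd (fun y => f y i j) x h = 'd f x h i j.
Proof.
by move=> df; rewrite (@diff_val _ _ _ _ _ _ _ (is_diff_comp_coord i j df)).
Qed.

Lemma C1_comp_coord (R : realType) (V : normedModType R) (m n : nat)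
    (f : V -> 'M[R]_(m, n)) i j : C1 f -> C1 (fun y => f y i j).
Proof.
move=> [df cdf]; split=> [x|v].
  by have := is_diff_comp_coord i j (df x); case.
rewrite (_ : (fun x => _) = fun x => 'd f x v i j).
  exact: continuous_coord_mx.
by apply/funext => x; rewrite diff_comp_coord.
Qed.

(** The mean value theorem is scalar, so the estimate is made on each coordinate; the sup norm then
    reassembles them without loss. *)
Lemma strict_diff (R : realType) (n m : nat) (f : 'rV[R]_n -> 'rV[R]_m)
    (x0 : 'rV[R]_n) (e : R) : C1 f -> 0 < e ->
  exists2 d : R, 0 < d & forall x h, `|x - x0| < d -> `|x + h - x0| < d ->
    `|f (x + h) - f x - 'd f x h| <= e * `|h|.
Proof.
move=> C1f e0.
have /choice[dd ddP] (i : 'I_m) : exists d : R, 0 < d /\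
    forall x h, `|x - x0| < d -> `|x + h - x0| < d ->
    `|f (x + h) 0 i - f x 0 i - 'd f x h 0 i| <= e * `|h|.
  have [d d0 dP] := strict_diff_scalar x0 (C1_comp_coord 0 i C1f) e0.
  exists d; split => // x h xd zd.
  by rewrite -diff_comp_coord; [exact: dP|exact: C1f.1].
(* The default value 1 keeps the radius positive even when m = 0. *)
exists (\big[Num.min/1]_i dd i).
  elim/big_ind: _ => [||i _]; [exact: ltr01| |exact: (ddP i).1].
  by move=> a b a0 b0; rewrite lt_min a0.
move=> x h xd zd; apply: norm_le_coord => [|i j].
  by rewrite mulr_ge0// ltW.
rewrite !mxE (ord1 i); apply: (ddP j).2.
  by apply: lt_le_trans xd _; exact: bigmin_le.
by apply: lt_le_trans zd _; exact: bigmin_le.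
Qed.

(** * The Newton field and one small step along it *)

Lemma continuous_subl (R : realType) (T : topologicalType)
    (W : normedModType R) (F : T -> W) (w : W) :
  continuous F -> continuous (fun x => w - F x).
Proof. by move=> cF x; apply: cvgB; [exact: cvg_cst|exact: cF]. Qed.

Lemma diff_jac (R : realType) (n : nat) (f : 'rV[R]_n -> 'rV[R]_n) (x u : 'rV[R]_n) :
  'd f x u = u *m jac f x.
Proof. by rewrite mul_rV_lin1. Qed.

Lemma continuous_jac (R : realType) (n : nat) (f : 'rV[R]_n -> 'rV[R]_n) :
  C1 f -> continuous (jac f).
Proof.
move=> [_ cf]; apply: continuous_mx_coord => i j.
rewrite (_ : (fun x => _) = fun x => 'd f x (delta_mx 0 i) 0 j).
  exact: continuous_coord_mx.
by apply/funext => x; rewrite mxE.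
Qed.

Lemma continuous_invjac (R : realType) (n : nat) (f : 'rV[R]_n -> 'rV[R]_n) :
  C1 f -> (forall x, \det (jac f x) != 0) ->
  continuous (fun x => invmx (jac f x)).
Proof.
move=> C1f df; apply: continuous_invmx; last exact: continuous_jac.
by move=> x; rewrite unitmxE unitfE.
Qed.

Lemma C1_continuous (R : realType) (V W : normedModType R) (f : V -> W) :
  C1 f -> continuous f.
Proof. by move=> [df _] x; exact: differentiable_continuous. Qed.

Lemma norm_mulmx_le (R : realType) (n : nat) (u : 'rV[R]_n) (A : 'M[R]_n) :
  `|u *m A| <= (\sum_j `|delta_mx 0 j *m A : 'rV[R]_n|) * `|u|.
Proof. exact: (norm_linear_le (mulmxr A)). Qed.

Lemma continuous_row_norms (R : realType) (T : topologicalType) (n : nat)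
    (A : T -> 'M[R]_n) : continuous A ->
  continuous (fun x => \sum_j `|delta_mx 0 j *m A x : 'rV[R]_n|).
Proof.
move=> cA; apply: continuous_sumr => j _.
rewrite (_ : (fun x => _) = fun x => `|delta_mx 0 j *m A x - 0 : 'rV[R]_n|).
  apply: continuous_dist; apply: continuous_mulmx => //.
  by move=> x; exact: cst_continuous.
by apply/funext => x; rewrite subr0.
Qed.

Definition newton (R : realType) (n : nat) (f : 'rV[R]_n -> 'rV[R]_n)
  (y x : 'rV[R]_n) : 'rV[R]_n := (y - f x) *m invmx (jac f x).

Lemma diff_newton (R : realType) (n : nat) (f : 'rV[R]_n -> 'rV[R]_n)
    (y x : 'rV[R]_n) : \det (jac f x) != 0 -> 'd f x (newton f y x) = y - f x.
Proof. by move=> dx; rewrite diff_jac mulmxKV// unitmxE unitfE. Qed.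

Lemma continuous_newton (R : realType) (n : nat) (f : 'rV[R]_n -> 'rV[R]_n)
    (y : 'rV[R]_n) : C1 f -> (forall x, \det (jac f x) != 0) ->
  continuous (newton f y).
Proof.
move=> C1f df; apply: continuous_mulmx; last exact: continuous_invjac.
by apply: continuous_subl; exact: C1_continuous.
Qed.

(** The tolerance 1 / (2L) is chosen so that the linearisation error of a step t v costs at most
    half of the gain t |z|. *)
Lemma newton_error_le (R : realType) (V W : normedModType R) (v : V) (z : W)
    (t L : R) : 0 <= t -> 0 < L -> `|v| <= L * `|z| ->
  (2 * L)^-1 * `|t *: v| <= t / 2 * `|z|.
Proof.
move=> t0 L0 vz; rewrite normrZ (ger0_norm t0) invfM mulrCA -mulrA ler_wpM2l//.
by rewrite -mulrA ler_wpM2l// ?invr_ge0// ler_pdivrMl.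
Qed.

(** Here r and a are the values of f before and after the step. The linear part leaves (1 - t) |y -
    r|, and the error adds at most t / 2 of |y - r|. *)
Lemma newton_step_norm_le (R : realType) (W : normedModType R) (y r a : W)
    (t : R) : 0 <= t <= 1 ->
  `|a - r - t *: (y - r)| <= t / 2 * `|y - r| ->
  `|y - a| <= (1 - t / 2) * `|y - r|.
Proof.
move=> /andP[t0 t1] H; rewrite distrC.
have -> : a - y = (a - r - t *: (y - r)) - (1 - t) *: (y - r).
  by rewrite scalerBl scale1r opprB addrA subrK opprB addrA subrK.
apply: le_trans (ler_normB _ _) _.
rewrite normrZ (@ger0_norm _ (1 - t)) ?subr_ge0//.
by move: H; set p := `|_|; lra.
Qed.

(** Here r and a are the values of k before and after the step, and D is the derivative of k along
    the Newton field. The extra 1 in M + 1 absorbs the linearisation error. *)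
Lemma newton_step_scalar_le (R : realType) (a r D t M N : R) : 0 <= t ->
  0 <= N -> `|D| <= M * N -> `|a - r - t * D| <= t / 2 * N ->
  a <= r + t * ((M + 1) * N).
Proof.
move=> t0 N0; rewrite !ler_norml => /andP[_ H1] /andP[_ H2].
have : t * D <= t * (M * N) by rewrite ler_wpM2l.
have : 0 <= t * N by rewrite mulr_ge0.
have -> : t * ((M + 1) * N) = t * (M * N) + t * N by lra.
have H3 : a - r - t * D <= t * N / 2 by move: H2; lra.
lra.
Qed.

(** The bound b x on the norm of f'(x)^-1 is continuous, so it stays below b x0 + 1 near x0. *)
Lemma newton_near_le (R : realType) (n : nat) (f : 'rV[R]_n -> 'rV[R]_n)
    (y x0 : 'rV[R]_n) : C1 f -> (forall x, \det (jac f x) != 0) ->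
  exists2 L : R, 0 < L &
    \forall x \near x0, `|newton f y x| <= L * `|y - f x|.
Proof.
move=> C1f df; have cb := continuous_row_norms (continuous_invjac C1f df).
set b := (fun x => _) in cb.
have b0 x : 0 <= b x by apply: sumr_ge0.
exists (b x0 + 1); first by rewrite ltr_wpDl.
have bx : \forall x \near x0, b x < b x0 + 1.
  by apply: continuous_near_lt => //; rewrite ltrDl.
near=> x; apply: le_trans (norm_mulmx_le _ _) _.
by rewrite ler_wpM2r//; apply: ltW; near: x.
Unshelve. all: by end_near. Qed.

(** The estimates hold jointly for x near x0 and t near 0 from the right, which is the form that
    compactness can make uniform. *)
Lemma newton_step_local (R : realType) (n : nat) (f : 'rV[R]_n -> 'rV[R]_n)
    (k : 'rV[R]_n -> R) (M : R) (y x0 : 'rV[R]_n) :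
  C1 f -> (forall x, \det (jac f x) != 0) -> C1 k ->
  (forall x u, `|'d k x (u *m invmx (jac f x))| <= M * `|u|) ->
  \forall x \near x0 & t \near 0^'+,
    `|y - f (x + t *: newton f y x)| <= (1 - t / 2) * `|y - f x| /\
    k (x + t *: newton f y x) <= k x + t * ((M + 1) * `|y - f x|).
Proof.
move=> C1f df C1k kM; have [L L0 nL] := newton_near_le y x0 C1f df.
have e0 : 0 < (2 * L)^-1 by rewrite invr_gt0 mulr_gt0.
have [d1 d10 d1P] := strict_diff x0 C1f e0.
have [d2 d20 d2P] := strict_diff_scalar x0 C1k e0.
pose d := Num.min d1 d2; have d0 : 0 < d by rewrite lt_min d10.
(* C bounds the field near x0. Half of the radius d is reserved for x - x0 and half for the
   displacement, whence t < d / 2 / C below. *)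
pose C := `|newton f y x0 - 0| + 1.
have C0 : 0 < C by rewrite ltr_wpDl.
have nC : \forall x \near x0, `|newton f y x - 0| < C.
  apply: continuous_near_lt; last by rewrite ltrDl.
  by apply: continuous_dist; exact: continuous_newton.
have nd : \forall x \near x0, `|x - x0| < d / 2.
  apply: continuous_near_lt; last by rewrite subrr normr0 divr_gt0.
  by apply: continuous_dist => x.
near=> x t => /=.
have t01 : 0 <= t <= 1.
  by apply/andP; split; near: t; [exact: nbhs_right_ge|exact: nbhs_right_le].
have xd : `|x - x0| < d / 2 by near: x.
have vL : `|newton f y x| <= L * `|y - f x| by near: x.
have vC : `|newton f y x| < C by rewrite -[newton f y x]subr0; near: x.
have td : t < d / 2 / C by near: t; apply: nbhs_right_lt; rewrite !divr_gt0.
move: t01 => /andP[t0 t1].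
have tv : `|t *: newton f y x| < d / 2.
  rewrite normrZ ger0_norm//; move: td; rewrite ltr_pdivlMr//.
  by apply: le_lt_trans; rewrite ler_wpM2l// ltW.
have x'd : `|x + t *: newton f y x - x0| < d.
  rewrite addrAC [d]splitr; apply: le_lt_trans (ler_normD _ _) _.
  exact: ltrD.
have x2d : `|x - x0| < d
  by apply: lt_trans xd _; rewrite ltr_pdivrMr// ltr_pMr// ltr1n.
have dE : 'd f x (t *: newton f y x) = t *: (y - f x).
  by rewrite linearZ; congr (_ *: _); exact: diff_newton.
have t01 : 0 <= t <= 1 by rewrite t0.
have eN := newton_error_le t0 L0 vL.
have [xd1 xd2] : `|x - x0| < d1 /\ `|x - x0| < d2.
  by apply/andP; rewrite -lt_min.
have [x'd1 x'd2] : `|x + t *: newton f y x - x0| < d1 /\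
    `|x + t *: newton f y x - x0| < d2 by apply/andP; rewrite -lt_min.
split.
  apply: (newton_step_norm_le t01).
  by rewrite -dE; exact: le_trans (d1P _ _ xd1 x'd1) eN.
have kE : 'd k x (t *: newton f y x) = t * 'd k x (newton f y x).
  by rewrite linearZ.
apply: (newton_step_scalar_le t0 (normr_ge0 _) (kM x (y - f x))).
rewrite -/(newton f y x) -kE; exact: le_trans (d2P _ _ xd2 x'd2) eN.
Unshelve. all: by end_near. Qed.

(** * Compact sublevel sets and the discrete Newton flow *)

Lemma coercive_compact (R : realType) (n : nat) (k h : 'rV[R]_n -> R) (c : R) :
  coercive k -> continuous h -> (forall x, k x <= h x) ->
  compact [set x | h x <= c].
Proof.
move=> [_ kco] ch kh; apply: bounded_closed_compact.
  (* Coercivity yields only a non-strict lower bound on k, so c + 1 is used to contradict k x <=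
     c. *)
  have [r rP] := kco (c + 1); exists r; split; first exact: num_real.
  move=> s rs x /= hx; apply: le_trans (ltW rs); apply: le_trans (norm_le_enorm x) _.
  rewrite leNgt; apply/negP => /rP kx.
  by have := le_trans kx (le_trans (kh x) hx); rewrite gerDl ler10.
by apply: closed_comp (@closed_le R c) => x _; exact: ch.
Qed.

(** The near-covering form of compactness turns the local step sizes into a single t valid on all of
    K. *)
Lemma compact_newton_step (R : realType) (n : nat) (f : 'rV[R]_n -> 'rV[R]_n)
    (k : 'rV[R]_n -> R) (M : R) (y : 'rV[R]_n) (K : set 'rV[R]_n) :
  C1 f -> (forall x, \det (jac f x) != 0) -> C1 k ->
  (forall x u, `|'d k x (u *m invmx (jac f x))| <= M * `|u|) ->
  compact K -> exists2 t : R, 0 < t <= 1 & forall x, K x ->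
    `|y - f (x + t *: newton f y x)| <= (1 - t / 2) * `|y - f x| /\
    k (x + t *: newton f y x) <= k x + t * ((M + 1) * `|y - f x|).
Proof.
move=> C1f df C1k kM /compact_near_coveringP cK.
have /cK nearK : forall x, K x -> \forall x' \near x & t \near 0^'+,
    `|y - f (x' + t *: newton f y x')| <= (1 - t / 2) * `|y - f x'| /\
    k (x' + t *: newton f y x') <= k x' + t * ((M + 1) * `|y - f x'|).
  by move=> x _; exact: newton_step_local.
near (0 : R)^'+ => t; exists t; last by near: t; exact: nearK.
by apply/andP; split; near: t; [exact: nbhs_right_gt|exact: nbhs_right_le].
Unshelve. all: by end_near. Qed.

Lemma continuous_addZ (R : realType) (T : topologicalType) (g h : T -> R) (c : R) :
  continuous g -> continuous h -> continuous (fun x => g x + c * h x).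
Proof.
by move=> cg ch x; apply: cvgD; [exact: cg|apply: cvgM; [exact: cvg_cst|exact: ch]].
Qed.

Lemma continuous_add_scale (R : realType) (V : normedModType R) (v : V -> V)
    (t : R) : continuous v -> continuous (fun x => x + t *: v x).
Proof.
by move=> cv x; apply: cvgD; [exact: cvg_id|apply: cvgZr; exact: cv].
Qed.

(** The weight 2 (M + 1) makes the balance exact: a step lowers |y - f| by at least t / 2 of itself,
    which pays for the rise of k by at most t (M + 1) |y - f|. Preimages of y are fixed since the
    field vanishes there. *)
Lemma newton_flow (R : realType) (n : nat) (f : 'rV[R]_n -> 'rV[R]_n)
    (k : 'rV[R]_n -> R) (M c : R) (y : 'rV[R]_n)
    (K := [set x | k x + 2 * (M + 1) * `|y - f x| <= c]) :
  C1 f -> (forall x, \det (jac f x) != 0) -> C1 k -> coercive k -> 0 <= M ->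
  (forall x u, `|'d k x (u *m invmx (jac f x))| <= M * `|u|) ->
  compact K /\
  exists (eta : 'rV[R]_n -> 'rV[R]_n) (q : R),
    [/\ continuous eta, 0 <= q < 1,
      forall x, K x -> K (eta x) /\ `|y - f (eta x)| <= q * `|y - f x| &
      forall x, f x = y -> eta x = x].
Proof.
move=> C1f df C1k kco M0 kM.
have cN : continuous (fun x => `|f x - y|).
  by apply: continuous_dist; exact: C1_continuous.
have cK : compact K.
  apply: (coercive_compact kco) => [|x]; last first.
    by rewrite lerDl !mulr_ge0// addr_ge0.
  rewrite (_ : (fun x => _) = fun x => k x + 2 * (M + 1) * `|f x - y|); last first.
    by apply/funext => x; rewrite distrC.
  apply: continuous_addZ => //; exact: C1_continuous.
split => //.
have [t /andP[t0 t1] tP] := compact_newton_step y C1f df C1k kM cK.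
exists (fun x => x + t *: newton f y x), (1 - t / 2); split.
- by apply: continuous_add_scale; exact: continuous_newton.
- by apply/andP; split; lra.
- move=> x Kx; have [P1 P2] := tP x Kx; split=> //; apply: le_trans Kx.
  have : 2 * (M + 1) * `|y - f (x + t *: newton f y x)| <=
      2 * (M + 1) * ((1 - t / 2) * `|y - f x|).
    by rewrite ler_wpM2l// mulr_ge0// addr_ge0.
  by move: P2; set N := `|y - f x|; nra.
- by move=> x fx; rewrite /newton fx subrr mul0mx scaler0 addr0.
Qed.

(** * Local expansion and surjectivity *)

Lemma norm_le_diff (R : realType) (n : nat) (f : 'rV[R]_n -> 'rV[R]_n)
    (x : 'rV[R]_n) : \det (jac f x) != 0 ->
  exists2 L : R, 0 < L & forall h, `|h| <= L * `|'d f x h|.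
Proof.
move=> dx; pose b := \sum_j `|delta_mx 0 j *m invmx (jac f x) : 'rV[R]_n|.
have b0 : 0 <= b by apply: sumr_ge0.
exists (b + 1); first by rewrite ltr_wpDl.
move=> h; rewrite diff_jac -{1}[h](@mulmxK _ _ _ (jac f x)) ?unitmxE ?unitfE//.
by apply: le_trans (norm_mulmx_le _ _) _; rewrite ler_wpM2r// lerDl.
Qed.

(** With h = x - x0, invertibility gives |h| <= L |f'(x0) h|, and the linearisation error
    contributes at most |h| / 2, which moves to the left side. In particular x0 is an isolated
    preimage. *)
Lemma local_expansion (R : realType) (n : nat) (f : 'rV[R]_n -> 'rV[R]_n)
    (x0 : 'rV[R]_n) : C1 f -> \det (jac f x0) != 0 ->
  exists L d : R, [/\ 0 < L, 0 < d &
    forall x, `|x - x0| < d -> `|x - x0| <= L * `|f x - f x0|].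
Proof.
move=> C1f dx; have [L L0 LP] := norm_le_diff dx.
have e0 : 0 < (2 * L)^-1 by rewrite invr_gt0 mulr_gt0.
have [d d0 dP] := strict_diff x0 C1f e0.
exists (2 * L), d; split=> [||x xd]; [by rewrite mulr_gt0|by []|].
have := dP x0 (x - x0); rewrite subrr normr0 subrKC => /(_ d0 xd).
move: (x - x0) (LP (x - x0)) => h; move: ('d f x0 h) (f x - f x0) => w v hw.
move=> vw; have : L * `|w| <= L * (`|v| + (2 * L)^-1 * `|h|).
  rewrite ler_wpM2l ?(ltW L0)// -lerBlDl; apply: le_trans vw.
  by apply: le_trans (lerB_dist _ _) _; rewrite distrC.
rewrite mulrDr mulrA invfM [L * (_ * _)]mulrCA divff ?gt_eqF// mulr1.
by move: hw; lra.
Qed.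

Lemma exists_preimage (R : realType) (n : nat) (f : 'rV[R]_n -> 'rV[R]_n)
    (k : 'rV[R]_n -> R) (M : R) (y x0 : 'rV[R]_n) :
  C1 f -> (forall x, \det (jac f x) != 0) -> C1 k -> coercive k -> 0 <= M ->
  (forall x u, `|'d k x (u *m invmx (jac f x))| <= M * `|u|) ->
  exists2 x, f x = y & k x <= k x0 + 2 * (M + 1) * `|y - f x0|.
Proof.
move=> C1f df C1k kco M0 kM.
set c := k x0 + _.
have [cK [eta [q [_ /andP[q0 q1] etaP _]]]] := newton_flow c y C1f df C1k kco M0 kM.
set K := [set x | _] in cK etaP.
have K0 : K !=set0 by exists x0; rewrite /K/= lexx.
have cN : continuous (fun x => `|f x - y|).
  by apply: continuous_dist; exact: C1_continuous.
have [x /set_mem Kx xmin] := EVT_min_rV K0 cK (continuous_subspaceT cN).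
have [Kex ex] := etaP x Kx.
(* Minimality gives |y - f x| <= |y - f (eta x)| <= q |y - f x| with q < 1. *)
have fx0 : `|y - f x| = 0.
  have := xmin _ (mem_set Kex); rewrite distrC (distrC _ y) => xe.
  have := normr_ge0 (y - f x); move: ex xe.
  move: `|y - f x| `|y - f _| => a b ? ? ?; apply/eqP; rewrite eq_le.
  by apply/andP; split => //; nra.
exists x; first by apply/esym/eqP; rewrite -subr_eq0 -normr_eq0 fx0.
by move: Kx; rewrite /K/= fx0 mulr0 addr0.
Qed.

(** * Injectivity by deforming a segment *)

Lemma continuous_line (R : realType) (V : normedModType R) (x h : V) :
  continuous (fun t : R => x + t *: h).
Proof.
by move=> t; apply: cvgD; [exact: cvg_cst|apply: cvgZl; exact: cvg_id].
Qed.

Lemma continuous_comp_fun (S T U : topologicalType) (g : S -> T) (h : T -> U) :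
  continuous g -> continuous h -> continuous (h \o g).
Proof. by move=> cg ch x; apply: continuous_comp; [exact: cg|exact: ch]. Qed.

Lemma continuous_iter (T : topologicalType) (g : T -> T) (N : nat) :
  continuous g -> continuous (iter N g).
Proof.
move=> cg; elim: N => [|N IH] x; first exact: cvg_id.
by apply: (@continuous_comp _ _ _ (iter N g) g); [exact: IH|exact: cg].
Qed.

Lemma iter_contract (R : realType) (T : Type) (g : T -> T) (K : set T)
    (s : T -> R) (q : R) (N : nat) (x : T) : 0 <= q ->
  (forall x, K x -> K (g x) /\ s (g x) <= q * s x) -> K x ->
  K (iter N g x) /\ s (iter N g x) <= q ^+ N * s x.
Proof.
move=> q0 gP Kx; elim: N => [|N [KN sN]]; first by rewrite expr0 mul1r.
have [KS sS] := gP _ KN; split=> //.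
by apply: le_trans sS _; rewrite exprS -mulrA ler_wpM2l.
Qed.

Lemma exists_expr_lt (R : realType) (q D e : R) : 0 <= q < 1 -> 0 < e ->
  exists N, q ^+ N * D < e.
Proof.
move=> /andP[q0 q1] e0.
have q1' : `|q| < 1 by rewrite ger0_norm.
have /cvgr_lt /(_ e e0) [N _ NP] := cvg_geometric D q1'.
by exists N; rewrite mulrC; exact: NP N (leqnn N).
Qed.

Lemma preimage_inj (R : realType) (n : nat) (f : 'rV[R]_n -> 'rV[R]_n)
    (k : 'rV[R]_n -> R) (M : R) :
  C1 f -> (forall x, \det (jac f x) != 0) -> C1 k -> coercive k -> 0 <= M ->
  (forall x u, `|'d k x (u *m invmx (jac f x))| <= M * `|u|) ->
  injective f.
Proof.
move=> C1f df C1k kco M0 kM x1 x2 f12; apply/eqP/negPn/negP => /eqP x12.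
pose y := f x1.
have cf := C1_continuous C1f; have ck := C1_continuous C1k.
have [L [r [L0 r0 rP]]] := local_expansion C1f (df x1).
pose line (t : R) := x1 + t *: (x2 - x1).
have cline : continuous line by exact: continuous_line.
pose G x := k x + 2 * (M + 1) * `|f x - y|.
have cG : continuous G.
  by apply: continuous_addZ => //; exact: continuous_dist.
(* The level c is the maximum of G on the segment, so that the whole segment lies in K. *)
have [t0 _ t0P] := @EVT_max R (G \o line) 0 1 ler01
  (continuous_subspaceT (continuous_comp_fun cline cG)).
pose c := G (line t0).
have [cK [eta [q [ceta q01 etaP eta0]]]] := newton_flow c y C1f df C1k kco M0 kM.
set K := [set x | _] in cK etaP.
have KE x : K x = (G x <= c) by rewrite /K/= /G distrC.
have Kline t : 0 <= t <= 1 -> K (line t).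
  by move=> t01; rewrite KE; apply: t0P; rewrite in_itv.
have cN : continuous (fun x => `|f x - y|) by exact: continuous_dist.
have K0 : K !=set0 by exists (line 0); apply: Kline; rewrite lexx ler01.
have [z _ zmax] := EVT_max_rV K0 cK (continuous_subspaceT cN).
pose D := `|f z - y|.
have KD x : K x -> `|y - f x| <= D by move=> Kx; rewrite distrC; exact/zmax/mem_set.
have cS : continuous (fun x : 'rV[R]_n => `|x - x1|) by apply: continuous_dist => x.
(* The radius r / 2 < r puts this sphere inside the region of local expansion, so |f - y| is
   positive on it; compactness gives the lower bound e. If S is empty, any e works. *)
pose S := K `&` [set x : 'rV[R]_n | `|x - x1| = r / 2].
have compS : compact S.
  apply: compact_closedI => //.
  apply: (@closed_comp _ _ (fun x : 'rV[R]_n => `|x - x1|)) (@closed_eq R (r / 2)).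
  by move=> x _; exact: cS.
have [e e0 eP] : exists2 e : R, 0 < e & forall x, S x -> e <= `|f x - y|.
  have [S0|/set0P/negP/negPn/eqP S0] := pselect (S !=set0); last first.
    by exists 1 => // x; rewrite S0.
  have [s /set_mem [Ks /= sr] smin] := EVT_min_rV S0 compS (continuous_subspaceT cN).
  exists `|f s - y|; last by move=> x Sx; exact/smin/mem_set.
  have := rP s; rewrite sr ltr_pdivrMr// ltr_pMr// ltr1n => /(_ isT).
  have r20 : 0 < r / 2 by rewrite divr_gt0.
  by move=> /(lt_le_trans r20); rewrite pmulr_rgt0.
(* D bounds |f - y| on K, so N steps bring it below e at every point of the segment at once. *)
have [N NP] := exists_expr_lt D q01 e0.
have /andP[q0 q1] := q01.
pose p (t : R) := `|iter N eta (line t) - x1|.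
have cp : continuous p.
  have cit : continuous (iter N eta) by exact: continuous_iter.
  apply: (@continuous_dist R R _ (iter N eta \o line)).
  exact: (continuous_comp_fun cline cit).
have iterx x : f x = y -> iter N eta x = x.
  by move=> fx; elim: (N) => //= j ->; exact: eta0.
have p0 : p 0 = 0 by rewrite /p /line scale0r addr0 iterx// subrr normr0.
(* If x2 were closer to x1 than r / 2, local expansion would force x2 = x1. *)
have p1 : r / 2 <= p 1.
  rewrite /p /line scale1r subrKC iterx -?f12// leNgt; apply/negP => pr.
  have /rP : `|x2 - x1| < r
    by apply: lt_trans pr _; rewrite ltr_pdivrMr// ltr_pMr// ltr1n.
  rewrite f12 subrr normr0 mulr0 normr_le0 subr_eq0 => /eqP x21.
  exact: x12.
have r20 : 0 <= r / 2 by rewrite divr_ge0// ltW.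
have [t /itvP t01 pt] : exists2 t, t \in `[0, 1]%R & p t = r / 2.
  apply: IVT => //; first exact: continuous_subspaceT.
  by rewrite p0 min_l ?max_r ?(le_trans r20)// r20.
have Kt : K (line t) by apply: Kline; rewrite !t01.
have [Kw yw] := iter_contract (s := fun x => `|y - f x|) N q0 etaP Kt.
(* The crossing point lies in S, where |f - y| >= e, yet the iteration made |f - y| < e there. *)
have := eP _ (conj Kw pt); apply/negP; rewrite -ltNge distrC.
apply: le_lt_trans yw _; apply: le_lt_trans NP.
by rewrite ler_wpM2l ?exprn_ge0//; exact: KD.
Qed.

(** * Regularity of the inverse *)

Lemma continuous_shift (R : realType) (V : normedModType R) (y : V) :
  continuous (fun h : V => h + y).
Proof. by move=> h; apply: cvgD; [exact: cvg_id|exact: cvg_cst]. Qed.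

(** With J = f'(g y) and w = g (h + y) - g y, the remainder w - h J^-1 equals -(h - w J) J^-1. As h
    is the increment of f along w, strict differentiability bounds h - w J by a small multiple of
    |w|, and local expansion gives |w| <= L |h|. *)
Lemma inverse_expansion (R : realType) (n : nat) (f g : 'rV[R]_n -> 'rV[R]_n)
    (y : 'rV[R]_n) (e : R) :
  C1 f -> (forall x, \det (jac f x) != 0) -> cancel g f -> continuous g ->
  0 < e -> \forall h \near (0 : 'rV[R]_n),
    `|g (h + y) - (g y + h *m invmx (jac f (g y)))| <= e * `|h|.
Proof.
move=> C1f df gK cg e0.
pose b := \sum_j `|delta_mx 0 j *m invmx (jac f (g y)) : 'rV[R]_n|.
have b0 : 0 <= b by apply: sumr_ge0.
have b10 : 0 < b + 1 by rewrite ltr_wpDl.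
have [L [d1 [L0 d10 LP]]] := local_expansion C1f (df (g y)).
(* The tolerance compensates the factor b from J^-1 and L from local expansion; b + 1 keeps the
   denominator positive. *)
have e'0 : 0 < e / ((b + 1) * L) by rewrite divr_gt0// mulr_gt0.
have [d2 d20 dP] := strict_diff (g y) C1f e'0.
have gd : \forall h \near (0 : 'rV[R]_n), `|g (h + y) - g y| < Num.min d1 d2.
  apply: continuous_near_lt; last by rewrite add0r subrr normr0 lt_min d10.
  apply: continuous_dist; exact: (continuous_comp_fun (@continuous_shift R _ y) cg).
near=> h.
have [xd1 xd2] : `|g (h + y) - g y| < d1 /\ `|g (h + y) - g y| < d2.
  by apply/andP; rewrite -lt_min; near: h.
have := LP _ xd1; have := dP (g y) (g (h + y) - g y).
rewrite subrr normr0 subrKC !gK addrK => /(_ d20 xd2) H1 H2.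
move: H1; rewrite diff_jac.
have -> : g (h + y) - (g y + h *m invmx (jac f (g y))) =
    - ((h - (g (h + y) - g y) *m jac f (g y)) *m invmx (jac f (g y))).
  by rewrite mulmxBl mulmxK ?unitmxE ?unitfE// opprB opprD addrA.
move=> H1; rewrite normrN; apply: le_trans (norm_mulmx_le _ _) _.
rewrite -/b; apply: (@le_trans _ _ ((b + 1) * (e / ((b + 1) * L) * (L * `|h|)))).
  apply: ler_pM => //; first by rewrite lerDl.
  by apply: le_trans H1 _; rewrite ler_wpM2l// ltW.
rewrite le_eqVlt; apply/orP; left; apply/eqP; field.
by rewrite !gt_eqF.
Unshelve. all: by end_near. Qed.

Lemma continuous_mulmxr (R : realType) (n : nat) (A : 'M[R]_n) :
  continuous (mulmxr A : 'rV[R]_n -> 'rV[R]_n).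
Proof.
apply: (@continuous_mulmx R _ 1 n n id (fun=> A)) => x; first exact: cvg_id.
exact: cst_continuous.
Qed.

(** The expansion identifies the derivative of g at y as right multiplication by f'(g y)^-1, which
    is continuous in y as a composite. *)
Lemma inverse_C1 (R : realType) (n : nat) (f g : 'rV[R]_n -> 'rV[R]_n) :
  C1 f -> (forall x, \det (jac f x) != 0) -> cancel g f -> continuous g -> C1 g.
Proof.
move=> C1f df gK cg.
pose A y : 'M[R]_n := invmx (jac f (g y)).
have dgA y : is_diff y g (mulmxr (A y)).
  have gE : g \o shift y = cst (g y) + mulmxr (A y) +o_ 0 id.
    by apply/eqaddoP => e e0; exact: inverse_expansion.
  have dE := diff_unique (@continuous_mulmxr R n (A y)) gE.
  apply: DiffDef => //; apply/diff_locallyP; rewrite dE; split=> //.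
  exact: continuous_mulmxr.
split=> [y|v]; first by case: (dgA y).
rewrite (_ : (fun y => _) = fun y => v *m A y); last first.
  by apply/funext => y; rewrite (@diff_val _ _ _ _ _ _ _ (dgA y)).
apply: continuous_mulmx; first by move=> x; exact: cst_continuous.
exact: continuous_comp_fun cg (continuous_invjac C1f df).
Qed.

Lemma continuous_dist_lt (R : realType) (T : topologicalType)
    (W : normedModType R) (g : T -> W) :
  (forall x e, 0 < e -> \forall y \near x, `|g y - g x| < e) -> continuous g.
Proof.
move=> gP x; apply/cvgrPdist_lt => e e0.
by apply: filterS (gP x e e0) => y; rewrite distrC.
Qed.

Lemma inverse_continuous (R : realType) (n : nat) (f g : 'rV[R]_n -> 'rV[R]_n)
    (k : 'rV[R]_n -> R) (C : R) : continuous f -> coercive k ->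
  cancel f g -> cancel g f -> 0 <= C ->
  (forall x y, k (g y) <= k x + C * `|y - f x|) -> continuous g.
Proof.
move=> cf kco fK gK C0 kg; apply: continuous_dist_lt => y0 e e0.
(* For |y - y0| <= 1 the bound on k puts g y in this compact sublevel set. On its part at distance
   at least e from g y0, f avoids y0, hence |f - y0| >= d for some d > 0; so |y - y0| < d forces g y
   within e of g y0. *)
pose S := [set x | k x <= k (g y0) + C] `&` [set x : 'rV[R]_n | e <= `|x - g y0|].
have compS : compact S.
  apply: compact_closedI.
    by apply: (coercive_compact kco); [exact: kco.1|move=> x].
  have cd : continuous (fun x : 'rV[R]_n => `|x - g y0|).
    by apply: continuous_dist => x.
  apply: (@closed_comp _ _ (fun x : 'rV[R]_n => `|x - g y0|)) (@closed_ge R e).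
  by move=> x _; exact: cd.
have cN : continuous (fun x => `|f x - y0|) by exact: continuous_dist.
have [d d0 dP] : exists2 d : R, 0 < d & forall x, S x -> d <= `|f x - y0|.
  have [S0|/set0P/negP/negPn/eqP S0] := pselect (S !=set0); last first.
    by exists 1 => // x; rewrite S0.
  have [s /set_mem [_ /= se] smin] := EVT_min_rV S0 compS (continuous_subspaceT cN).
  exists `|f s - y0|; last by move=> x Sx; exact/smin/mem_set.
  rewrite normr_gt0 subr_eq0; apply/eqP => fs.
  by move: se; rewrite -fs fK subrr normr0 leNgt e0.
have nd : \forall y \near y0, `|y - y0| < Num.min d 1.
  apply: continuous_near_lt; last by rewrite subrr normr0 lt_min d0 ltr01.
  by apply: continuous_dist => x.
near=> y.
have /andP[yd y1] : (`|y - y0| < d) && (`|y - y0| < 1) by rewrite -lt_min; near: y.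
rewrite ltNge; apply/negP => ey.
have Sgy : S (g y).
  split=> //=; apply: le_trans (kg (g y0) y) _; rewrite gK lerD2l.
  by rewrite ler_piMr// ltW.
by have := dP _ Sgy; rewrite gK leNgt yd.
Unshelve. all: by end_near. Qed.

Lemma diffeo_of_coercive (R : realType) (n : nat) (f : 'rV[R]_n -> 'rV[R]_n)
    (k : 'rV[R]_n -> R) (M : R) :
  C1 f -> (forall x, \det (jac f x) != 0) -> C1 k -> coercive k -> 0 <= M ->
  (forall x u, `|'d k x (u *m invmx (jac f x))| <= M * `|u|) -> diffeo f.
Proof.
move=> C1f df C1k kco M0 kM.
have finj := preimage_inj C1f df C1k kco M0 kM.
have ex y x0 := exists_preimage y x0 C1f df C1k kco M0 kM.
have /choice[g gK] (y : 'rV[R]_n) : exists x, f x = y.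
  by have [x fx _] := ex y 0; exists x.
have fK : cancel f g by move=> x; apply: finj; rewrite gK.
exists g; split; [exact: fK|exact: gK|exact: C1f|].
apply: (inverse_C1 C1f df gK).
apply: (inverse_continuous (C1_continuous C1f) kco fK gK (C := 2 * (M + 1))).
  by rewrite mulr_ge0// addr_ge0.
(* Injectivity identifies the preimage z built from x with g y, so the bound on k passes to g y for
   every x. *)
by move=> x y; have [z fz kz] := ex y x; rewrite -{1}fz fK.
Qed.

(** * A coercive function for a given diffeomorphism *)

Lemma is_diff_sqrt1D2 (R : realType) (V : normedModType R) (phi : V -> R) (x : V) :
  differentiable phi x ->
  is_diff x (fun y => Num.sqrt (1 + phi y ^+ 2))
    (fun v => phi x / Num.sqrt (1 + phi x ^+ 2) * 'd phi x v).
Proof.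
move=> dphi; pose psi (t : R) := Num.sqrt (1 + t ^+ 2).
have p0 (t : R) : 0 < 1 + t ^+ 2 by rewrite ltr_pwDl// sqr_ge0.
have dpsi (t : R) : is_derive t 1 psi (t / psi t).
  have d1 : is_derive t 1 (fun s : R => 1 + s ^+ 2) (2 * t).
    have H : is_derive t 1 (cst 1 + (@id R) ^+ 2) (0 + 2%:R *: (t ^+ 1) *: 1).
      exact: is_deriveD.
    apply: (is_derive_eq H).
    by rewrite add0r expr1 /GRing.scale/= mulr1.
  have := @is_derive1_comp R Num.sqrt (fun s : R => 1 + s ^+ 2) t _ _
    (is_derive1_sqrt (p0 t)) d1.
  rewrite (_ : _ * _ = t / psi t)//.
  by rewrite -/(psi t); field; rewrite gt_eqF// sqrtr_gt0.
have dpsi' t : differentiable psi t by apply/derivable1_diffP; case: (dpsi t).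
have H := is_diff_comp (differentiableP dphi) (differentiableP (dpsi' (phi x))).
apply: (is_diff_eq H); apply/funext => v /=.
rewrite diff1E// derive1E; have [_ ->] := dpsi (phi x).
by rewrite /GRing.scale/= mulrC.
Qed.

Lemma is_diff_bigsum (R : realType) (V W : normedModType R) (I : Type)
    (r : seq I) (F D : I -> V -> W) (x : V) :
  (forall i, is_diff x (F i) (D i)) ->
  is_diff x (fun y => \sum_(i <- r) F i y) (fun v => \sum_(i <- r) D i v).
Proof.
move=> FD; elim: r => [|i r IH].
  have -> : (fun y => \sum_(i <- [::]) F i y) = cst 0.
    by apply/funext => y; rewrite big_nil.
  have -> : (fun v => \sum_(i <- [::]) D i v) = 0.
    by apply/funext => v; rewrite big_nil.
  exact: is_diff_cst.
have -> : (fun y => \sum_(j <- i :: r) F j y) =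
    F i + (fun y => \sum_(j <- r) F j y).
  by apply/funext => y; rewrite big_cons.
have -> : (fun v => \sum_(j <- i :: r) D j v) =
    D i + (fun v => \sum_(j <- r) D j v).
  by apply/funext => v; rewrite big_cons.
exact: is_diffD.
Qed.

(** A smooth substitute for the l^1 norm of f x: each term dominates |f_i| and is a 1-Lipschitz
    function of f_i. *)
Definition sum_sqrt1D2 (R : realType) (n : nat) (f : 'rV[R]_n -> 'rV[R]_n)
  (x : 'rV[R]_n) : R := \sum_i Num.sqrt (1 + f x 0 i ^+ 2).
Lemma continuous_sqrt1D2_ratio (R : realType) (T : topologicalType)
    (p q : T -> R) : continuous p -> continuous q ->
  continuous (fun x => p x / Num.sqrt (1 + p x ^+ 2) * q x).
Proof.
move=> cp cq x; apply: cvgM; last exact: cq.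
apply: cvgM; first exact: cp.
apply: cvgV; first by rewrite gt_eqF// sqrtr_gt0 ltr_pwDl// sqr_ge0.
apply: continuous_cvg; first exact: sqrt_continuous.
by apply: cvgD; [exact: cvg_cst|apply: cvgM; exact: cp].
Qed.

Lemma is_diff_sum_sqrt1D2 (R : realType) (n : nat) (f : 'rV[R]_n -> 'rV[R]_n)
    (x : 'rV[R]_n) : differentiable f x ->
  is_diff x (sum_sqrt1D2 f)
    (fun v => \sum_i f x 0 i / Num.sqrt (1 + f x 0 i ^+ 2) * 'd f x v 0 i).
Proof.
move=> df; apply: is_diff_bigsum => i.
have dfi := is_diff_comp_coord 0 i df.
have H := is_diff_sqrt1D2 (@ex_diff _ _ _ _ _ _ _ dfi).
by apply: (is_diff_eq H); apply/funext => v; rewrite (@diff_val _ _ _ _ _ _ _ dfi).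
Qed.

Lemma sqrt1D2_gt0 (R : realType) (t : R) : 0 < Num.sqrt (1 + t ^+ 2).
Proof. by rewrite sqrtr_gt0 ltr_pwDl// sqr_ge0. Qed.

Lemma norm_le_sqrt1D2 (R : realType) (t : R) : `|t| <= Num.sqrt (1 + t ^+ 2).
Proof. by rewrite -sqrtr_sqr ler_wsqrtr// lerDr. Qed.

Lemma C1_sum_sqrt1D2 (R : realType) (n : nat) (f : 'rV[R]_n -> 'rV[R]_n) :
  C1 f -> C1 (sum_sqrt1D2 f).
Proof.
move=> C1f; have dk x := is_diff_sum_sqrt1D2 (C1f.1 x).
split=> [x|v]; first by case: (dk x).
rewrite (_ : (fun x => _) = fun x =>
    \sum_i f x 0 i / Num.sqrt (1 + f x 0 i ^+ 2) * 'd f x v 0 i); last first.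
  by apply/funext => x; rewrite (@diff_val _ _ _ _ _ _ _ (dk x)).
apply: continuous_sumr => i _.
apply: continuous_sqrt1D2_ratio; apply: continuous_coord_mx.
  exact: C1_continuous.
exact: C1f.2.
Qed.

(** Where the sum is below M, f x lies in a compact ball, so x = g (f x) lies in its bounded image
    under g. *)
Lemma coercive_sum_sqrt1D2 (R : realType) (n : nat) (f g : 'rV[R]_n -> 'rV[R]_n) :
  C1 f -> continuous g -> cancel f g -> coercive (sum_sqrt1D2 f).
Proof.
move=> C1f cg fK; split; first exact/C1_continuous/C1_sum_sqrt1D2.
(* The radius is |M| so that the ball is nonempty even for negative M. *)
move=> M; pose K := [set y : 'rV[R]_n | `|y| <= `|M|].
have cn : continuous (fun y : 'rV[R]_n => `|y|) by exact: norm_continuous.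
have cK : compact K.
  apply: bounded_closed_compact.
    exists `|M|; split; first exact: num_real.
    by move=> s Ms y /= /le_trans; apply; exact: ltW.
  apply: (@closed_comp _ _ (fun y : 'rV[R]_n => `|y|)) (@closed_le R `|M|).
  by move=> y _; exact: cn.
have K0 : K !=set0 by exists 0; rewrite /K/= normr0.
have [z _ zmax] := EVT_max_rV K0 cK
  (continuous_subspaceT (continuous_comp_fun cg cn)).
exists (n%:R * `|g z|) => x; apply: contraLR; rewrite -ltNge -leNgt => kM.
apply: le_trans (enorm_le_norm x) _; rewrite ler_wpM2l//.
have Kfx : K (f x).
  apply: norm_le_coord => // i j; rewrite (ord1 i).
  apply: le_trans (norm_le_sqrt1D2 _) _; apply: le_trans (ler_norm M).
  apply: le_trans (ltW kM); rewrite /sum_sqrt1D2 (bigD1 j)//= lerDl.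
  by apply: sumr_ge0 => l _; rewrite ltW// sqrt1D2_gt0.
by have := zmax _ (mem_set Kfx); rewrite /= fK.
Qed.

(** The factor f'(x) cancels its inverse, leaving n terms u_i f_i / sqrt (1 + f_i^2), each at most
    |u| in absolute value. *)
Lemma diff_sum_sqrt1D2_le (R : realType) (n : nat) (f : 'rV[R]_n -> 'rV[R]_n)
    (x u : 'rV[R]_n) : differentiable f x -> \det (jac f x) != 0 ->
  `|'d (sum_sqrt1D2 f) x (u *m invmx (jac f x))| <= n%:R * enorm u.
Proof.
move=> df dx; rewrite (@diff_val _ _ _ _ _ _ _ (is_diff_sum_sqrt1D2 df)).
rewrite diff_jac mulmxKV ?unitmxE ?unitfE//.
apply: (@le_trans _ _ (n%:R * `|u|)); last by rewrite ler_wpM2l// norm_le_enorm.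
apply: le_trans (ler_norm_sum _ _ _) _.
apply: (@le_trans _ _ (\sum_(i < n) `|u|)); last first.
  by rewrite sumr_const card_ord mulr_natl.
apply: ler_sum => i _; rewrite normrM; apply: le_trans (coord_le_norm u 0 i).
rewrite ler_piMl// normrM normfV (gtr0_norm (sqrt1D2_gt0 _)).
by rewrite ler_pdivrMr ?sqrt1D2_gt0// mul1r norm_le_sqrt1D2.
Qed.

(** The chain rule applied to g o f = id exhibits an inverse of the Jacobian matrix. *)
Lemma det_jac_neq0 (R : realType) (n : nat) (f g : 'rV[R]_n -> 'rV[R]_n)
    (x : 'rV[R]_n) : cancel f g -> differentiable f x -> differentiable g (f x) ->
  \det (jac f x) != 0.
Proof.
move=> fK df dg.
have jK : jac f x *m jac g (f x) = 1%:M.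
  apply/row_matrixP => i; rewrite row_mul row1 rowE -diff_jac -diff_jac.
  transitivity ('d (g \o f) x (delta_mx 0 i)); last first.
    have -> : g \o f = id by apply/funext => z /=; rewrite fK.
    by rewrite (@diff_val _ _ _ _ _ _ _ (is_diff_id x)).
  have E := @diff_comp _ _ _ _ f g x df dg.
  exact: (esym (congr1 (fun D => D (delta_mx 0 i)) E)).
by have [uf _] := mulmx1_unit jK; rewrite -unitfE -unitmxE.
Qed.

Theorem theorem4p3 (R : realType) (n : nat) (f : 'rV[R]_n -> 'rV[R]_n) :
  C1 f ->
  (diffeo f <->
   ((forall x, \det (jac f x) != 0) /\
    exists k : 'rV[R]_n -> R,
      [/\ C1 k, (forall x, 0 <= k x), coercive k &
       exists M : R, forall x u : 'rV[R]_n,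
         `|'d k x (u *m invmx (jac f x))| <= M * enorm u])).
Proof.
move=> C1f; split=> [[g [fK gK _ C1g]]|[df [k [C1k _ kco [M kM]]]]].
  have df x := det_jac_neq0 fK (C1f.1 x) (C1g.1 (f x)).
  split; first exact: df.
  exists (sum_sqrt1D2 f); split.
  - exact: C1_sum_sqrt1D2.
  - by move=> x; apply: sumr_ge0 => i _; rewrite ltW// sqrt1D2_gt0.
  - exact: coercive_sum_sqrt1D2 C1f (C1_continuous C1g) fK.
  - by exists n%:R => x u; apply: diff_sum_sqrt1D2_le; [exact: C1f.1|exact: df].
(* The factor n passes from the Euclidean norm to the sup norm, and |M| makes the constant
   nonnegative. *)
have M0 : 0 <= `|M| * n%:R by rewrite mulr_ge0.
apply: (diffeo_of_coercive C1f df C1k kco M0) => x u.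
apply: le_trans (kM x u) _; apply: (@le_trans _ _ (`|M| * enorm u)).
  by rewrite ler_wpM2r ?sqrtr_ge0// ler_norm.
by rewrite -mulrA ler_wpM2l// enorm_le_norm.
Qed.
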